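(* Every minimal labeling $\lambda$ of a finite geometric lattice is polygon strong. Thus, $\lambda$ is polygon complete.
   Context: For an element $x$ of a finite geometric lattice $L$, $A(x)$ is the set of atoms of $L$ below (or equal to) $x$. For a total ordering $\Omega$ of the atoms of $L$, the minimal labeling induced by $\Omega$ is the edge labeling $\lambda_\Omega(x,y)=\min_\Omega(A(y)\setminus A(x))$ for $x\lessdot y$, with labels ordered by $\Omega$; it is an EL-labeling. For a finite poset $P$ with least element $\hat 0$ and greatest element $\hat 1$, $\mathcal M(P)$ is the set of maximal chains. For a chain $c$ and $x\in c$ write $c^x=\{w\in c: w\le x\}$, $c_x=\{w\in c: w\ge x\}$. An edge labeling $\lambda$ assigns to each cover relation a label in a poset $\Lambda$; a saturated chain gets the sequence of labels of its edges from bottom to top. A sequence is ascending if weakly increasing. $\lambda$ is an EL-labeling if for every $x<y$ the interval $[x,y]$ has a unique ascending maximal chain and it lexicographically precedes all other maximal chains of $[x,y]$. A saturated chain $u\lessdot v\lessdot w$ is a descent if $\lambda(u,v)\not\le\lambda(v,w)$. An EL-labeling is polygon strong if for each descent $x\lessdot y\lessdot z$ one has $\lambda(y,z)<\lambda(y',z)$, where $y'$ is the coatom of $[x,z]$ contained in the unique ascending maximal chain of $[x,z]$. Polygon move: $m\to m'$ if there are $x<z$ in $m\cap m'$ with $m^x=m'^x$, $m_z=m'_z$, such that $m'\cap[x,z]$ is a descent $x\lessdot y\lessdot z$ with $y\notin m$, while $m\cap[x,z]$ is the unique ascending maximal chain of $[x,z]$. The maximal chain descent order $P_\lambda(2)$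 is $\mathcal M(P)$ partially ordered by the reflexive and transitive closure of $\to$. $\lambda$ is polygon complete if $m\to m'$ always implies that $m'$ covers $m$ in $P_\lambda(2)$. *)

(* Defs.v *)
From mathcomp Require Import all_boot all_order.

Set Implicit Arguments.
Unset Strict Implicit.
Unset Printing Implicit Defensive.

Import Order.Theory.
Local Open Scope order_scope.

Definition covers_in (T : finType) (r : rel T) (x y : T) : bool :=
  [&& x != y, r x y & [forall z, r x z && r z y ==> (z == x) || (z == y)]].

Definition poset_on (T : Type) (D : {pred T}) (r : rel T) : Prop :=
  [/\ {in D, reflexive r}, {in D &, antisymmetric r}
    & {in D & &, transitive r}].

Section Chains.
Context {d : Order.disp_t} {P : finTBPOrderType d}.
Implicit Types (x y z : P) (c S : {set P}).

Definition covers x y : bool := covers_in <=%O x y.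

Definition closed_itv x y : {set P} := [set w | x <= w <= y].

Definition chain c : bool := [forall x in c, forall y in c, x >=< y].

Definition maximal_chain S c : bool :=
  maxset (fun c' => chain c' && (c' \subset S)) c.

Definition chain_below c x : {set P} := [set w in c | w <= x].
Definition chain_above c x : {set P} := [set w in c | x <= w].

End Chains.

Definition maxchain {d : Order.disp_t} (P : finTBPOrderType d) :=
  {c : {set P} | maximal_chain [set: P] c}.

(* The label poset is the subset Lam of Lab ordered by le. The values of lam   *)
(* at pairs that are not cover relations are irrelevant.                       *)
Section Labelings.
Context {d : Order.disp_t} {P : finTBPOrderType d} {Lab : eqType}.
Variables (Lam : {pred Lab}) (le : rel Lab) (lam : P -> P -> Lab).
Implicit Types (x y z : P) (c : {set P}) (m : maxchain P).

Definition label_lt (a b : Lab) : bool := (a != b) && le a b.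

Fixpoint lex_lt (s t : seq Lab) : bool :=
  match s, t with
  | _, [::] => false
  | [::], _ :: _ => true
  | a :: s', b :: t' => label_lt a b || (a == b) && lex_lt s' t'
  end.

Definition chain_labels c : seq Lab :=
  if sort <=%O (enum c) is x :: s then pairmap lam x s else [::].

Definition ascending_chain x y c : bool :=
  maximal_chain (closed_itv x y) c && sorted le (chain_labels c).

Definition unique_ascending_chain x y c : bool :=
  ascending_chain x y c &&
  [forall c' : {set P}, ascending_chain x y c' ==> (c' == c)].

Definition edge_labeling : Prop :=
  poset_on Lam le /\ (forall x y, covers x y -> lam x y \in Lam).

Definition EL_labeling : Prop :=
  edge_labeling /\
  forall x y, x < y ->
    exists2 c, unique_ascending_chain x y c &
      forall c', maximal_chain (closed_itv x y) c' -> c' != c ->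
        lex_lt (chain_labels c) (chain_labels c').

Definition descent x y z : bool :=
  [&& covers x y, covers y z & ~~ le (lam x y) (lam y z)].

Definition polygon_strong : Prop :=
  EL_labeling /\
  forall x y z, descent x y z ->
    forall c y', unique_ascending_chain x z c ->
      y' \in c -> covers y' z ->
      label_lt (lam y z) (lam y' z).

Definition polygon_move m m' : bool :=
  [exists x, exists z,
    [&& x \in \val m :&: \val m', z \in \val m :&: \val m', x < z,
        chain_below (\val m) x == chain_below (\val m') x,
        chain_above (\val m) z == chain_above (\val m') z,
        [exists y, [&& descent x y z, y \notin \val m
                     & \val m' :&: closed_itv x z == [set x; y; z]]]
      & unique_ascending_chain x z (\val m :&: closed_itv x z)]].

Definition chain_descent_le : rel (maxchain P) := connect polygon_move.

Definition polygon_complete : Prop :=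
  EL_labeling /\
  forall m m', polygon_move m m' -> covers_in chain_descent_le m m'.

End Labelings.

Section Geometric.
Context {d : Order.disp_t} (L : finTBLatticeType d).
Implicit Types (x y : L).

Definition atoms : {set L} := [set a | covers \bot a].

Definition atomistic : Prop :=
  forall x, exists2 S : {set L}, S \subset atoms & x = \join_(a in S) a.

Definition semimodular : Prop :=
  forall x y, covers (x `&` y) x -> covers y (x `|` y).

Definition geometric_lattice : Prop := atomistic /\ semimodular.

Definition atoms_below x : {set L} := [set a in atoms | a <= x].

Variable Omega : rel L.

Definition atom_ordering : Prop :=
  poset_on (mem atoms) Omega /\ {in atoms &, total Omega}.

(* The default \bot is never taken at a cover relation of an atomistic lattice *)
(* when Omega is a total ordering of the atoms.                                *)
Definition minimal_labeling x y : L :=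
  let D := atoms_below y :\: atoms_below x in
  odflt \bot [pick a in D | [forall b in D, Omega a b]].

End Geometric.

(* Main.v *)
Require Import Defs.
From mathcomp Require Import all_boot all_order.
From mathcomp Require Import zify.

(** Write lam for the minimal labeling. The key remark is that lam x y, the
    minimum of A(y) \ A(x), makes sense for every x < y and controls the whole
    interval [x, y]: along a maximal chain of [x, y] every label is an atom of
    A(y) \ A(x), hence at least lam x y (label_mono), and the step of the chain
    that first rises above the atom lam x y is labelled by it (label_eq). So
    lam x y is a label of every maximal chain of [x, y], and it is the smallest
    one.

    Consequently an ascending maximal chain of [x, y] must start with the label
    lam x y, that is, with the element x \/ lam x y, which covers x by
    semimodularity. Iterating gives a unique ascending chain, and any chain that
    leaves it has a larger label at that point: lam is an EL-labeling. For a
    descent x < y < z the first label is not lam x z, hence the second one is,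
    whereas the last label of the ascending chain of [x, z] differs from
    lam x z, as that atom is already used; this is polygon strength.

    For polygon completeness, semimodularity shows that the ascending chain of a
    rank two interval [x, z] has a single inner element b, so that a polygon
    move replaces one element b by an element y. It increases the label of the
    edge above x (from lam x b = lam x z to lam x y) and, by polygon strength, it
    decreases the label of the edge below z (from lam b z to lam y z = lam x z).
    Hence the moves increase the chains lexicographically when their labels are
    read from the bottom, and decrease them when their labels are read from the
    top. If m moves to m' through [x, z], every chain u between m and m' in the
    descent order is squeezed by both lexicographic orders, and agrees with m
    and m' up to x and from z on: u differs from them at most by its element w
    between x and z. If u is neither m nor m', then some move arrives at u and
    another one leaves u, both at w; the first makes x < w < z a descent, and
    the second requires it to be ascending. *)

Set Implicit Arguments.
Unset Strict Implicit.
Unset Printing Implicit Defensive.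

Import Order.Theory.
Local Open Scope order_scope.

(** * Maximal chains as sequences of covers *)

Section ChainSequences.
Context {d : Order.disp_t} {P : finTBPOrderType d}.
Implicit Types (x y z w : P) (c : {set P}) (s t : seq P).

Lemma coversP x y :
  reflect (x < y /\ forall z, x <= z -> z < y -> z = x) (covers x y).
Proof.
apply: (iffP and3P) => [[nxy lxy /forallP H]|[lxy H]].
  have ltxy : x < y by rewrite lt_neqAle nxy.
  split=> // z xz zy; have := H z; rewrite xz (ltW zy) /= => /orP[/eqP //|].
  by rewrite (lt_eqF zy).
split; [by rewrite (lt_eqF lxy) | exact: ltW |].
apply/forallP => z; apply/implyP => /andP[xz].
by rewrite le_eqVlt => /orP[->|/(H _ xz) ->]; rewrite ?eqxx ?orbT.
Qed.

Lemma covers_lt x y : covers x y -> x < y.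
Proof. by case/coversP. Qed.

Lemma covers_between x y z : covers x y -> x < z -> z <= y -> z = y.
Proof.
case/coversP=> _ H xz; rewrite le_eqVlt => /orP[/eqP //|/(H _ (ltW xz)) zx].
by rewrite zx ltxx in xz.
Qed.

Lemma path_covers_lt x s : path covers x s -> path <%O x s.
Proof. exact/sub_path/covers_lt. Qed.

Lemma path_covers_le_last x s : path covers x s -> x <= last x s.
Proof.
elim: s x => //= a s IH x /andP[/covers_lt xa /IH]; exact/le_trans/ltW.
Qed.

Lemma path_covers_le x s w : path covers x s -> w \in x :: s -> x <= w.
Proof.
move/path_covers_lt => sP; rewrite inE => /predU1P[->//|ws].
by have /allP/(_ w ws)/ltW := order_path_min lt_trans sP.
Qed.

Definition chain_seq c : seq P := sort <=%O (enum c).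

Lemma mem_chain_seq c : chain_seq c =i c.
Proof. by move=> w; rewrite mem_sort mem_enum. Qed.

Lemma chain_seq_sorted c : chain c -> sorted <%O (chain_seq c).
Proof.
move=> /forallP cP; rewrite lt_sorted_uniq_le sort_uniq enum_uniq /=.
apply: (@sort_sorted_in _ (mem c)); last by apply/allP => w; rewrite mem_enum.
move=> u v uc vc; have := cP u; rewrite uc /= => /forallP/(_ v).
by rewrite vc.
Qed.

Lemma sorted_comparable s : sorted <%O s -> {in s &, forall u v, u >=< v}.
Proof.
move=> /lt_sorted_leq_nth sN u v us vs; have {}sN := sN u.
rewrite -(nth_index u us) -(nth_index u vs).
case/orP: (leq_total (index u s) (index v s)) => le.
  by apply: le_comparable; rewrite sN ?inE ?index_mem.
by apply: ge_comparable; rewrite sN ?inE ?index_mem.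
Qed.

Lemma sorted_chain s c : sorted <%O s -> s =i c -> chain c.
Proof.
move=> /sorted_comparable sC sc.
apply/forallP => u; apply/implyP; rewrite -sc => us.
by apply/forallP => v; apply/implyP; rewrite -sc; apply: sC.
Qed.

Lemma chain_seq_eq s c : sorted <%O s -> s =i c -> chain_seq c = s.
Proof.
move=> sP sc; apply: lt_sorted_eq => //.
  exact/chain_seq_sorted/(sorted_chain sP).
by move=> w; rewrite mem_chain_seq sc.
Qed.

Lemma maximal_chainW S c : maximal_chain S c -> chain c /\ c \subset S.
Proof. by case/maxsetP=> /andP[]. Qed.

(** This is how maximality gets used: it turns comparability with the chain into
    membership. *)
Lemma maximal_chain_mem S c w : maximal_chain S c -> w \in S ->
  {in c, forall u, w >=< u} -> w \in c.
Proof.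
case/maxsetP=> /andP[/forallP cC cS] cM wS wC.
suff <- : w |: c = c by rewrite setU11.
apply: cM; last exact: subsetUr.
rewrite subUset sub1set wS cS !andbT.
apply/forallP => u; apply/implyP => uc; apply/forallP => v; apply/implyP.
move: uc; rewrite !inE => /predU1P[->|uc] /predU1P[->|vc] //.
- exact: comparablexx.
- exact: wC.
- by rewrite comparable_sym wC.
- by have := cC u; rewrite uc => /forallP/(_ v); rewrite vc.
Qed.

(** Sets are awkward for inductions along a chain; together with
    path_maximal_chain this identifies the maximal chains of [x, y] with the
    cover paths from x to y. Consecutive elements of the sorted chain cover each
    other because an element strictly between them would be comparable to the
    whole chain. *)
Lemma maximal_chain_path x y c : x <= y -> maximal_chain (closed_itv x y) c ->
  exists2 s, chain_seq c = x :: s & path covers x s /\ last x s = y.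
Proof.
move=> xy cM; have [cC /subsetP cS] := maximal_chainW cM.
have xc : x \in c.
  apply: (maximal_chain_mem cM); first by rewrite inE lexx.
  by move=> u /cS; rewrite inE => /andP[/le_comparable].
have yc : y \in c.
  apply: (maximal_chain_mem cM); first by rewrite inE lexx xy.
  by move=> u /cS; rewrite inE => /andP[_ /ge_comparable].
have := chain_seq_sorted cC; have sE := mem_chain_seq c.
case: (chain_seq c) sE => [|a s] sE sP; first by have := sE x; rewrite xc.
have lo u : u \in a :: s -> a <= u.
  rewrite inE => /predU1P[->//|us].
  by have /allP/(_ u us)/ltW := order_path_min lt_trans sP.
have ax : a = x.
  apply/eqP; rewrite eq_le lo ?sE //=.
  by have := cS a; rewrite -sE mem_head inE => /(_ isT) /andP[].
subst a; exists s => //; split.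
  change (is_true (sorted covers (x :: s))); apply/(sortedP x) => i ib.
  have ni : nth x (x :: s) i \in c by rewrite -sE mem_nth // ltnW.
  have ni1 : nth x (x :: s) i.+1 \in c by rewrite -sE mem_nth.
  have := cS _ ni; have := cS _ ni1; rewrite !inE => /andP[_ hi] /andP[xi _].
  have H := lt_sorted_leq_nth x sP.
  apply/coversP; split; first by apply: (sortedP x sP).
  move=> w iw wi1; apply/eqP; rewrite eq_sym eq_le iw /=.
  have : w \in c.
    apply: (maximal_chain_mem cM).
      by rewrite inE (le_trans xi iw) (ltW (lt_le_trans wi1 hi)).
    move=> u; rewrite -sE => us; rewrite -(nth_index x us).
    case: (leqP (index u (x :: s)) i) => iu.
      by apply/ge_comparable/le_trans/iw; rewrite H ?inE ?index_mem // ltnW.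
    by apply/le_comparable/(le_trans (ltW wi1)); rewrite H ?inE ?index_mem.
  rewrite -sE => ws; have := ws; rewrite -index_mem => jb.
  move: jb (nth_index x ws) wi1; move: (index w _) => j jb <-.
  by rewrite (lt_sorted_ltn_nth x sP) ?H ?inE // ltnW.
apply/eqP; rewrite eq_le.
have := cS (last x s); rewrite -sE mem_last inE => /(_ isT) /andP[_ ->] /=.
move: yc; rewrite -sE => ys.
rewrite -{1}(nth_index x ys) -[last x s]/(last x (x :: s)) -nth_last.
have := ys; rewrite -index_mem => iy.
by rewrite (lt_sorted_leq_nth x sP) ?inE // -?ltnS.
Qed.

Lemma mem_path_covers x s w : path covers x s -> x <= w -> w <= last x s ->
  {in x :: s, forall u, w >=< u} -> w \in x :: s.
Proof.
elim: s x => [|a s IH] x /=.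
  by move=> _ xw wx _; rewrite inE eq_le xw wx.
case/andP=> /coversP[xa Hxa] sP xw wl wC.
case: (comparable_leP (wC a _)) => [|wa|aw]; first by rewrite !inE eqxx orbT.
  move: wa; rewrite le_eqVlt => /predU1P[->|]; first by rewrite !inE eqxx orbT.
  by move=> /(Hxa _ xw) ->; rewrite mem_head.
rewrite inE IH ?orbT // ?ltW // => u us.
by apply: wC; rewrite inE us orbT.
Qed.

Lemma path_chain_seq x s : path covers x s ->
  chain_seq [set w in x :: s] = x :: s.
Proof.
by move=> sP; apply: chain_seq_eq => [|w]; rewrite ?inE //; apply: path_covers_lt.
Qed.

Lemma path_covers_ge x s w : path covers x s -> w \in x :: s -> w <= last x s.
Proof.
elim: s x => [|a s IH] x /=; first by rewrite inE => _ /eqP->.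
case/andP=> /covers_lt/ltW xa sP; rewrite inE => /predU1P[->|]; last exact: IH.
exact/(le_trans xa)/path_covers_le_last.
Qed.

Lemma path_maximal_chain x s : path covers x s ->
  maximal_chain (closed_itv x (last x s)) [set w in x :: s].
Proof.
move=> sP; apply/maxsetP; split=> [|c' /andP[/forallP c'C /subsetP c'S] sub].
  have -> /= : chain [set w in x :: s].
    apply: (@sorted_chain (x :: s)) => [|w]; last by rewrite !inE.
    exact: path_covers_lt.
  apply/subsetP => w; rewrite [in X in X -> _]inE => ws.
  by rewrite inE (path_covers_le sP ws) (path_covers_ge sP ws).
apply/eqP; rewrite eqEsubset sub andbT; apply/subsetP => w wc'.
have := c'S w wc'; rewrite [in X in X -> _]inE => /andP[xw wl].
rewrite inE; apply: (mem_path_covers sP) => // u us.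
have := c'C w; rewrite wc' => /forallP/(_ u)/implyP; apply.
by apply: (subsetP sub); rewrite inE.
Qed.

Lemma chain_sub c c' : c' \subset c -> chain c -> chain c'.
Proof.
move=> /subsetP sub /forallP cC.
apply/forallP => u; apply/implyP => /sub uc.
apply/forallP => v; apply/implyP => /sub vc.
by have := cC u; rewrite uc => /forallP/(_ v); rewrite vc.
Qed.

(** The two outer parts only depend on the portions of c below x and above z,
    which a polygon move preserves. *)
Lemma chain_seq_split c x w z : chain c -> x < w -> w < z ->
    c :&: closed_itv x z = [set x; w; z] ->
  chain_seq c = chain_seq (chain_below c x :\ x) ++
                [:: x, w, z & chain_seq (chain_above c z :\ z)].
Proof.
move=> cC xw wz cE; have xz := lt_trans xw wz.
have mE u : (u \in c) && (x <= u <= z) = [|| u == x, u == w | u == z].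
  by have := congr1 (fun A : {set P} => u \in A) cE; rewrite /= !inE orbA.
have bC : chain (chain_below c x :\ x).
  by apply: chain_sub cC; apply/subsetP => u; rewrite !inE => /and3P[].
have aC : chain (chain_above c z :\ z).
  by apply: chain_sub cC; apply/subsetP => u; rewrite !inE => /and3P[].
have lox u : u \in chain_seq (chain_below c x :\ x) -> u < x.
  by rewrite mem_chain_seq !inE lt_neqAle => /and3P[-> _ ->].
have hiz u : u \in chain_seq (chain_above c z :\ z) -> z < u.
  by rewrite mem_chain_seq !inE lt_neqAle eq_sym => /and3P[-> _ ->].
apply: chain_seq_eq => [|u].
  rewrite lt_sorted_pairwise pairwise_cat /= -!lt_sorted_pairwise.
  rewrite !chain_seq_sorted // xw xz wz !andbT /=.
  apply/and4P; split; last by apply/allP => u /hiz.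
  - apply/allrelP => u v /lox ux; rewrite !inE.
    case/or4P=> [/eqP->//|/eqP->|/eqP->|/hiz zv].
    + exact: lt_trans xw.
    + exact: lt_trans xz.
    + exact/(lt_trans ux)/(lt_trans xz).
  - by apply/allP => u /hiz/(lt_trans xz).
  - by apply/allP => u /hiz/(lt_trans wz).
rewrite mem_cat !inE !mem_chain_seq !inE.
have -> a b e f g : [|| a, b, e, f | g] = [|| a, [|| b, e | f] | g].
  by rewrite !orbA.
rewrite -mE; case: (boolP (u \in c)) => [uc|_] /=; last by rewrite !andbF.
have cmp v : v \in c -> u >=< v.
  by move: cC => /forallP/(_ u); rewrite uc => /forallP/(_ v)/implyP.
have /andP[/cmp ux _] : (x \in c) && (x <= x <= z) by rewrite mE eqxx.
have /andP[/cmp uz _] : (z \in c) && (x <= z <= z) by rewrite mE eqxx !orbT.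
by case: (comparable_ltgtP ux) => //= _;
   case: (comparable_ltgtP uz) => //=; rewrite orbT.
Qed.

Lemma chain_seq_inj c c' : chain_seq c = chain_seq c' -> c = c'.
Proof. by move=> E; apply/setP => w; rewrite -!mem_chain_seq E. Qed.

Lemma chain_labels_path (Lab : eqType) (lam : P -> P -> Lab) c x s :
  chain_seq c = x :: s -> chain_labels lam c = pairmap lam x s.
Proof. by rewrite /chain_labels -/(chain_seq c) => ->. Qed.

End ChainSequences.

(** * A lexicographic order on sequences with context-dependent comparisons *)

Section LexicographicOrder.
Context {T : eqType} (R : T -> rel T).
Hypotheses (R_irr : forall x, irreflexive (R x)).
Hypotheses (R_trans : forall x, transitive (R x)).
Implicit Types (x a b : T) (s t p : seq T).

(** Two sequences that branch after a common element x are compared through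
    [R x]: for chains, this compares the labels of the edges at x that leave the
    common part. Chains read from the bottom and from the top are two instances.
    The sizes are required to agree because a squeezed chain must have as many
    elements as its bounds. *)
Fixpoint edge_lex x s t : bool :=
  match s, t with
  | [::], [::] => true
  | a :: s', b :: t' => if a == b then edge_lex a s' t'
                      else R x a b && (size s' == size t')
  | _, _ => false
  end.

Lemma edge_lex_refl x s : edge_lex x s s.
Proof. by elim: s x => //= a s IH x; rewrite eqxx. Qed.

Lemma edge_lex_size x s t : edge_lex x s t -> size s = size t.
Proof.
elim: s t x => [|a s IH] [|b t] x //=; case: eqVneq => _.
  by move/IH->.
by case/andP=> _ /eqP->.
Qed.

Lemma edge_lex_trans x : transitive (edge_lex x).
Proof.
move=> t s u; elim: s t u x => [|a s IH] [|b t] [|e u] x //=.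
case: (eqVneq a b) => [<-|ab].
  case: (eqVneq a e) => [_|_ /edge_lex_size->] //; exact: IH.
case: (eqVneq b e) => [<- /andP[Rab /eqP->] /edge_lex_size->|be].
  by rewrite (negbTE ab) Rab eqxx.
move=> /andP[Rab /eqP->] /andP[Rbe ->]; have Rae := R_trans Rab Rbe.
by case: (eqVneq a e) Rae => [->|_ ->] //; rewrite R_irr.
Qed.

Lemma edge_lex_cat u p x a b s : R x a b ->
  edge_lex u (p ++ [:: x, a & s]) (p ++ [:: x, b & s]).
Proof.
move=> Rab; elim: p u => [|e p IH] u /=; rewrite eqxx //.
by case: eqVneq Rab => [->|_ ->]; rewrite ?R_irr ?eqxx.
Qed.

(** Leaving p would be a strict increase at some entry, which the comparison with
    the upper sequence would have to undo at the very same entry. *)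
Lemma edge_lex_prefix u p s t v : edge_lex u (p ++ s) v ->
  edge_lex u v (p ++ t) -> prefix p v.
Proof.
elim: p u v => [|a p IH] u [|b v] //=.
rewrite (eq_sym b a); case: (eqVneq a b) => [->|ab]; first exact: IH.
by move=> /andP[Rab _] /andP[/(R_trans Rab)]; rewrite R_irr.
Qed.

End LexicographicOrder.

(** * Sequences that differ at one place *)

(** This locates a polygon move between two chains that are known to agree except
    at one element: the place where a' turns into b' is where they differ. *)
Lemma swap_position (T : eqType) (p p' : seq T) x x' a a' b b' z z' q q' :
    a' != b' ->
    p ++ [:: x, a, z & q] = p' ++ [:: x', a', z' & q'] ->
    p ++ [:: x, b, z & q] = p' ++ [:: x', b', z' & q'] ->
  [/\ x = x', a = a', b = b' & z = z'].
Proof.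
move=> nab; elim: p p' => [|e p IH] [|e' p'] /=.
- by case=> -> -> -> _ [->].
- move=> [_ eA] [_ eB]; case: p' eA eB => [|f p'] /=.
    by move=> [_ zA _] [_ zB _]; rewrite -zA -zB eqxx in nab.
  move=> [_ ->] [_ /eqP]; rewrite eqseq_cat //= => /andP[_].
  by rewrite !eqseq_cons (negbTE nab) andbF.
- move=> [_ eA] [_ eB]; case: p {IH} eA eB => [|f p] /=.
    by move=> [xA _ _] [xB _ _]; rewrite -xA -xB eqxx in nab.
  by move=> [fA _] [fB _]; rewrite -fA -fB eqxx in nab.
- by case=> _ eA [_ eB]; apply: IH eA eB.
Qed.

Lemma squeezed_seq (T : eqType) (s p q : seq T) x z :
    prefix (p ++ [:: x]) s -> prefix (rev q ++ [:: z]) (rev s) ->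
    size s = (size p + size q + 3)%N ->
  exists w, s = p ++ [:: x, w, z & q].
Proof.
move=> /prefixP[s1 ->] /prefixP[s2 /(congr1 rev)].
rewrite revK !rev_cat revK /= => sE.
case: s1 sE => [|w s1] sE; first by rewrite !size_cat /= => sz; lia.
rewrite !size_cat /= => sz; exists w.
move/(congr1 size): (sE); rewrite !size_cat !size_rev /= => sz2.
move/eqP: sE; rewrite -[w :: s1]cat1s catA eqseq_cat;
  last by rewrite !size_cat !size_rev /=; lia.
by case/andP=> _ /eqP->; rewrite -!catA.
Qed.

Lemma rev_cat3 (T : Type) (p q : seq T) (x w z : T) :
  rev (p ++ [:: x, w, z & q]) = rev q ++ [:: z, w, x & rev p].
Proof. by rewrite rev_cat !rev_cons -!cats1 -!catA. Qed.

Lemma connect_last (T : finType) (e : rel T) m u : connect e m u -> u != m ->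
  exists2 v, connect e m v & e v u.
Proof.
case/connectP=> r; case/lastP: r => [|r u'] /=; first by move=> _ ->; rewrite eqxx.
rewrite rcons_path last_rcons => /andP[rP uu'] -> _; exists (last m r) => //.
by apply/connectP; exists r.
Qed.

Lemma connect_first (T : finType) (e : rel T) m u : connect e m u -> u != m ->
  exists2 v, e m v & connect e v u.
Proof.
case/connectP=> [[|v r]] /=; first by move=> _ ->; rewrite eqxx.
by case/andP=> mv rP uE _; exists v => //; apply/connectP; exists r.
Qed.

(** * The minimal labeling *)

Section MinimalLabeling.
Context {d : Order.disp_t} {L : finTBLatticeType d} {Omega : rel L}.
Hypotheses (geomL : geometric_lattice L) (ordO : atom_ordering Omega).
Implicit Types (a b x y z w : L) (c : {set L}) (s t : seq L).

Let Omega_refl a : a \in atoms L -> Omega a a.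
Proof. by case: ordO => [[H _ _] _]; apply: H. Qed.

Let Omega_anti a b : a \in atoms L -> b \in atoms L ->
  Omega a b -> Omega b a -> a = b.
Proof. by case: ordO => [[_ H _] _] aA bA ab ba; apply: H => //; apply/andP. Qed.

Let Omega_trans : {in atoms L & &, transitive Omega}.
Proof. by case: ordO => [[_ _ H] _]. Qed.

(** Omega is an order on the atoms only; transporting it to natural numbers gives
    an order relation that behaves well on all of L. *)
Definition atom_rank a := #|[set b in atoms L | Omega b a]|.

Lemma atom_rank_le a b : a \in atoms L -> b \in atoms L ->
  (atom_rank a <= atom_rank b)%N = Omega a b.
Proof.
have rE e f : (e \in [set g in atoms L | Omega g f]) =
    (e \in atoms L) && Omega e f by rewrite in_set.
move=> aA bA; case: (boolP (Omega a b)) => [ab|nab].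
  apply/subset_leq_card/subsetP => e; rewrite !rE => /andP[eA ea].
  by rewrite eA (Omega_trans aA).
apply/negbTE; rewrite -ltnNge; apply/proper_card/properP.
have ba : Omega b a by case: ordO => _ /(_ a b aA bA); rewrite (negbTE nab).
split; last by exists a; rewrite rE ?(negbTE nab) ?andbF // aA Omega_refl.
apply/subsetP => e; rewrite !rE => /andP[eA eb].
by rewrite eA (Omega_trans bA).
Qed.

Lemma atom_rank_lt a b : a \in atoms L -> b \in atoms L ->
  (atom_rank a < atom_rank b)%N = label_lt Omega a b.
Proof.
move=> aA bA; rewrite /label_lt -atom_rank_le // ltn_neqAle.
congr (~~ _ && _); apply/eqP/eqP => [E|->//].
by apply: Omega_anti; rewrite // -atom_rank_le // E.
Qed.

(** The use of atomicity: it makes A(y) \ A(x) nonempty when x < y, so that the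
    labels are genuine minima. *)
Lemma atoms_below_sub x y : atoms_below y \subset atoms_below x -> y <= x.
Proof.
case: geomL => atomL _ /subsetP sub; have [S /subsetP SA yE] := atomL y.
rewrite [leLHS]yE; apply/joinsP => a aS.
suff : a \in atoms_below x by rewrite in_set => /andP[].
by apply: sub; rewrite in_set SA //= yE; apply: joins_sup.
Qed.

Lemma minimal_labelingP x y : x < y ->
  [/\ minimal_labeling Omega x y \in atoms L,
      minimal_labeling Omega x y <= y,
      ~~ (minimal_labeling Omega x y <= x)
    & forall b, b \in atoms L -> b <= y -> ~~ (b <= x) ->
        Omega (minimal_labeling Omega x y) b].
Proof.
move=> xy; rewrite /minimal_labeling; set D := _ :\: _.
have DE b : (b \in D) = [&& b \in atoms L, b <= y & ~~ (b <= x)].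
  by rewrite in_setD ![b \in atoms_below _]inE; case: (b \in atoms L);
    rewrite //= andbC.
have [a0 a0D] : exists a, a \in D.
  apply/set0Pn; rewrite setD_eq0; apply/negP => /atoms_below_sub.
  by rewrite (lt_geF xy).
case: pickP => [a /andP[] | noMin].
  rewrite DE => /and3P[aA ay ax] /forallP aM; split=> // b bA bY bx.
  by have := aM b; rewrite DE bA bY bx.
have [a aD aM] := @arg_minnP _ a0 (mem D) atom_rank a0D.
have := noMin a; rewrite -[a \in D]/(mem D a) aD => /forallP[] b.
apply/implyP => bD; have := aM b bD.
by rewrite atom_rank_le //; move: aD bD; rewrite /= !DE => /and3P[? _ _] /and3P[].
Qed.

Local Notation lam := (minimal_labeling Omega).

Lemma label_atom x y : x < y -> lam x y \in atoms L.
Proof. by case/minimal_labelingP. Qed.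

(** A(y') \ A(x') is contained in A(y) \ A(x). *)
Lemma label_mono x x' y' y : x <= x' -> x' < y' -> y' <= y ->
  Omega (lam x y) (lam x' y').
Proof.
move=> xx' xy' yy'.
have [_ _ _ H] := minimal_labelingP (le_lt_trans xx' (lt_le_trans xy' yy')).
have [aA ay nax _] := minimal_labelingP xy'.
by apply: H => //; [apply: le_trans yy' | apply: contra nax => /le_trans->].
Qed.

(** If the minimum of A(y) \ A(x) lies in the smaller set A(y') \ A(x'), it is
    also the minimum there. *)
Lemma label_eq x x' y' y : x <= x' -> x' < y' -> y' <= y ->
  lam x y <= y' -> ~~ (lam x y <= x') -> lam x' y' = lam x y.
Proof.
move=> xx' xy' yy' ay nax; have xy := le_lt_trans xx' (lt_le_trans xy' yy').
have [_ _ _ H] := minimal_labelingP xy'.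
apply: Omega_anti; [exact: label_atom | exact: label_atom | | exact: label_mono].
by apply: H => //; apply: label_atom.
Qed.

Lemma cover_join_label x y : covers x y -> x `|` lam x y = y.
Proof.
move=> xy; have [_ ay nax _] := minimal_labelingP (covers_lt xy).
move: (lam x y) ay nax => a ay nax.
apply: (covers_between xy); last by rewrite leUx ay ltW ?covers_lt.
by rewrite lt_neqAle leUl andbT; apply: contra nax => /eqP->; rewrite leUr.
Qed.

(** The meet of a and x is the bottom element, which a covers. *)
Lemma covers_join_atom x a : a \in atoms L -> ~~ (a <= x) -> covers x (x `|` a).
Proof.
rewrite inE => aA nax; rewrite joinC; case: geomL => _ sm; apply: sm.
have /coversP[_ H] := aA; rewrite (H (a `&` x)) ?le0x //.
by rewrite lt_neqAle leIl andbT; apply: contra nax => /eqP<-; rewrite leIr.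
Qed.

(** Some step of the path crosses the atom lam x y, and label_eq applies to it.
    The starting point u is kept apart from x for the induction. *)
Lemma label_in_path x y u s : path covers u s -> x <= u -> last u s <= y ->
    lam x y <= last u s -> ~~ (lam x y <= u) ->
  lam x y \in pairmap lam u s.
Proof.
elim: s u => [|b s IH] u /=; first by move=> _ _ _ ->.
case/andP=> ub bs xu sy al nau; rewrite inE.
case: (boolP (lam x y <= b)) => [ab|nab].
  rewrite (@label_eq x u b y) ?eqxx ?covers_lt //.
  exact: le_trans (path_covers_le_last bs) sy.
by rewrite IH ?orbT // (le_trans xu) // ltW // covers_lt.
Qed.

Lemma labels_bounded x y u s : path covers u s -> x <= u -> last u s <= y ->
  {in pairmap lam u s, forall a, a \in atoms L /\ Omega (lam x y) a}.
Proof.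
elim: s u => //= b s IH u /andP[/covers_lt ub bs] xu sy a.
rewrite inE => /predU1P[->|]; last by apply: IH => //; apply/(le_trans xu)/ltW.
rewrite label_atom //; split=> //; apply: label_mono => //.
exact: le_trans (path_covers_le_last bs) sy.
Qed.

(** The label lam x (last b t) occurs on the path and bounds all its labels from
    below, so an ascending path has to begin with it. *)
Lemma ascending_head x b t : path covers x (b :: t) ->
  sorted Omega (pairmap lam x (b :: t)) -> lam x b = lam x (last b t).
Proof.
move=> xt /= aP; set y := last b t; have /andP[xb bt] := xt.
have by_ : b <= y := path_covers_le_last bt.
have xy : x < y := lt_le_trans (covers_lt xb) by_.
have := label_in_path xt (lexx x) (lexx _); rewrite /= -/y.
have [_ -> -> _] := minimal_labelingP xy => /(_ isT isT).
rewrite inE => /predU1P[->//|inT].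
have tA : all (mem (atoms L)) (lam x b :: pairmap lam b t).
  apply/allP => a /(labels_bounded xt (lexx x) (lexx _)).
  by case.
have /allP/(_ _ inT) ba := order_path_min_in Omega_trans tA aP.
apply: Omega_anti => //; [exact/label_atom/covers_lt | exact: label_atom |].
by apply: label_mono => //; apply: covers_lt.
Qed.

(** The greedy path: add the smallest atom of A(y) \ A(x) to x, and start again
    from the join. A path with another first element has another first label,
    since a cover is the join of its lower element and its label; this label is
    larger, and by ascending_head the path is not ascending. *)
Lemma ascending_path_exists x y : x <= y -> exists s,
  [/\ path covers x s, last x s = y, sorted Omega (pairmap lam x s)
    & forall t, path covers x t -> last x t = y -> t != s ->
        lex_lt Omega (pairmap lam x s) (pairmap lam x t) /\
        ~~ sorted Omega (pairmap lam x t)].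
Proof.
have [n] := ubnP #|closed_itv x y|; elim: n x => // n IH x; rewrite ltnS => le_n.
rewrite le_eqVlt => /predU1P[<-|xy].
  exists [::]; split=> // -[//|b t] /= /andP[/covers_lt xb bt] tx.
  by have := path_covers_le_last bt; rewrite tx (lt_geF xb).
have [aA ay nax _] := minimal_labelingP xy; set a := lam x y in aA ay nax.
have xx1 := covers_join_atom aA nax; set x1 := x `|` a in xx1.
have x1y : x1 <= y by rewrite leUx ltW.
have [|s [x1s sy sO sM]] := IH x1 _ x1y.
  apply: leq_trans le_n; apply/proper_card/properP; split.
    apply/subsetP => w; rewrite !inE => /andP[xw ->]; rewrite andbT.
    by apply: le_trans xw; rewrite leUl.
  by exists x; rewrite !inE ?lexx ?(ltW xy) // (lt_geF (covers_lt xx1)).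
have xa : lam x x1 = a by apply: label_eq; rewrite ?covers_lt // leUr.
exists (x1 :: s); split=> //=; first by rewrite xx1.
  rewrite path_min_sorted // xa; apply/allP => e es.
  have s_le : last x1 s <= y by rewrite sy.
  by have [] := labels_bounded x1s (ltW (covers_lt xx1)) s_le es.
move=> [|b t] /=; first by move=> _ xE; rewrite xE ltxx in xy.
case/andP=> xb bt ty; rewrite eqseq_cons negb_and xa.
case: (eqVneq b x1) => [->|bx1] /= in bt ty *.
  move=> ts; have [lx nO] := sM t bt ty ts; rewrite xa eqxx lx orbT; split=> //.
  by apply: contra nO => /path_sorted.
(* From here on the path t leaves the greedy path at its first step. *)
move=> _; have by_ : b <= y by rewrite -ty path_covers_le_last.
have nab : lam x b != a.
  by apply: contra bx1 => /eqP E; rewrite -(cover_join_label xb) E.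
split.
  by rewrite /label_lt eq_sym nab label_mono // covers_lt.
apply: contra nab => tO; rewrite (@ascending_head x b t) ?ty //=.
by rewrite xb.
Qed.

Lemma minimal_labeling_EL : EL_labeling (mem (atoms L)) Omega lam.
Proof.
split; first by split; [case: ordO | move=> x y /covers_lt/label_atom].
move=> x y xy; have [s [xs sy sO sM]] := ascending_path_exists (ltW xy).
have sE := path_chain_seq xs.
have cM c' : maximal_chain (closed_itv x y) c' -> c' != [set w in x :: s] ->
    lex_lt Omega (chain_labels lam [set w in x :: s]) (chain_labels lam c') /\
    ~~ sorted Omega (chain_labels lam c').
  move=> /(maximal_chain_path (ltW xy))[t tE [xt ty]] c's.
  rewrite (chain_labels_path lam sE) (chain_labels_path lam tE); apply: sM => //.
  by apply: contra c's => /eqP ts; apply/eqP/chain_seq_inj; rewrite sE tE ts.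
exists [set w in x :: s]; last by move=> c' c'M /(cM c' c'M)[].
rewrite /unique_ascending_chain /ascending_chain (chain_labels_path lam sE) sO.
rewrite -{1}sy path_maximal_chain //=.
apply/forallP => c'; apply/implyP => /andP[c'M c'O]; apply/contraT => c's.
by have [_] := cM c' c'M c's; rewrite c'O.
Qed.

(** A maximal chain of [x, z] carries the label lam x z; in a descent this
    smallest label cannot come first, so it comes last. *)
Lemma descent_labels x y z : descent Omega lam x y z ->
  lam y z = lam x z /\ label_lt Omega (lam x z) (lam x y).
Proof.
case/and3P=> /covers_lt xy /covers_lt yz nO; have xz := lt_trans xy yz.
have nE : lam x z != lam x y.
  by apply: contra nO => /eqP <-; rewrite label_mono // ltW.
split; last by rewrite /label_lt nE label_mono // ltW.
have [_ az nax _] := minimal_labelingP xz.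
apply: label_eq => //; first exact: ltW.
by apply: contra nE => ay; rewrite [lam x y](@label_eq x x y z) // ltW.
Qed.

(** Above an element that already lies over the atom lam x z, this label cannot
    occur any more. *)
Lemma label_lt_above x y z : x < y -> y < z -> lam x z <= y ->
  label_lt Omega (lam x z) (lam y z).
Proof.
move=> xy yz ay; rewrite /label_lt label_mono ?(ltW xy) // andbT.
have [_ _ nay _] := minimal_labelingP yz.
by apply: contra nay => /eqP <-.
Qed.

Lemma ascending_chain_path x z c :
    x < z -> unique_ascending_chain Omega lam x z c ->
  exists b t, [/\ chain_seq c = [:: x, b & t], path covers x (b :: t),
     last b t = z & lam x b = lam x z].
Proof.
move=> xz /andP[/andP[cM cO] _].
have [[|b t] cE [xt tz]] := maximal_chain_path (ltW xz) cM.
  by move: xz; rewrite -tz ltxx.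
exists b, t; split=> //; rewrite -[in RHS]tz; apply: ascending_head => //.
by rewrite (chain_labels_path lam cE) in cO.
Qed.

Lemma minimal_labeling_polygon_strong :
  polygon_strong (mem (atoms L)) Omega lam.
Proof.
split=> [|x y z des c y' cU y'c y'z]; first exact: minimal_labeling_EL.
have [-> _] := descent_labels des; have /and3P[xy yz _] := des.
have xz := lt_trans (covers_lt xy) (covers_lt yz).
have [b [t [cE xt tz xb]]] := ascending_chain_path xz cU.
move: y'c; rewrite -mem_chain_seq cE inE => /predU1P[y'x|y't].
  have := covers_between y'z; rewrite y'x => /(_ y (covers_lt xy)).
  by move/(_ (ltW (covers_lt yz))) => yE; have := covers_lt yz; rewrite yE ltxx.
have /andP[/covers_lt xb' bt] := xt.
have by' := path_covers_le bt y't.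
apply: label_lt_above; [exact: lt_le_trans by' | exact: covers_lt |].
by apply: le_trans by'; rewrite -xb; case: (minimal_labelingP xb').
Qed.

(** * Polygon moves *)

(** What remains of a polygon move once chains are sequences: the inner element b
    of the ascending chain of [x, z] is replaced by y. *)
Definition polygon_swap s t := exists p x b y z q,
  [/\ s = p ++ [:: x, b, z & q], t = p ++ [:: x, y, z & q],
      lam y z = lam x b,
      (atom_rank (lam x b) < atom_rank (lam x y))%N
    & (atom_rank (lam y z) < atom_rank (lam b z))%N].

(** The ascending chain of [x, z] starts with an atomic join b distinct from y,
    so y /\ b = x; semimodularity applied twice gives y \/ b = z and then that z
    covers b, whence the chain is x < b < z. *)
Lemma polygon_move_swap (m m' : maxchain L) : polygon_move Omega lam m m' ->
  polygon_swap (chain_seq (val m)) (chain_seq (val m')).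
Proof.
case/existsP=> x /existsP[z /and5P[_ _ xz /eqP lowE]].
case/and3P=> [/eqP highE /existsP[y /and3P[des ym /eqP m'E]] cU].
have [lyz lt_xy] := descent_labels des; have /and3P[xy yz _] := des.
have [b [t [cE /= /andP[xb bt] tz lb]]] := ascending_chain_path xz cU.
have b_le_z : b <= z by rewrite -tz path_covers_le_last.
have byx : b `&` y = x.
  have /coversP[_ H] := xb; apply: H; first by rewrite lexI !ltW ?covers_lt.
  rewrite lt_neqAle leIl andbT; apply: contra ym => /eqP byb.
  have <- : b = y.
    by apply: (covers_between xy); rewrite ?covers_lt // -byb leIr.
  have : b \in chain_seq (val m :&: closed_itv x z) by rewrite cE !inE eqxx orbT.
  by rewrite mem_chain_seq inE => /andP[].
have [_ sm] := geomL.
have byz : b `|` y = z.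
  have yby : covers y (b `|` y) by apply: sm; rewrite byx.
  apply: (covers_between yz); first exact: covers_lt.
  by rewrite leUx b_le_z ltW ?covers_lt.
have bz : covers b z by rewrite -byz joinC; apply: sm; rewrite meetC byx.
have tE : t = [:: z].
  case: t bt tz {cE} => [|e t] /=; first by move=> _ bE; rewrite bE in bz;
    have := covers_lt bz; rewrite ltxx.
  case/andP=> be et tz; have ez : e = z.
    by apply: (covers_between bz); rewrite ?covers_lt // -tz path_covers_le_last.
  case: t et tz => [|f t] /=; first by rewrite ez.
  case/andP=> /covers_lt ef ft fz; have := path_covers_le_last ft.
  by rewrite fz -ez (lt_geF ef).
have mE : val m :&: closed_itv x z = [set x; b; z].
  by apply/setP => w; rewrite -mem_chain_seq cE tE !inE orbA.
have [mC _] := maximal_chainW (valP m); have [m'C _] := maximal_chainW (valP m').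
exists (chain_seq (chain_below (val m) x :\ x)), x, b, y, z.
exists (chain_seq (chain_above (val m) z :\ z)).
have [ltxb ltxy] := (covers_lt xb, covers_lt xy).
have [ltbz ltyz] := (covers_lt bz, covers_lt yz).
split; rewrite ?lyz ?lb //.
- exact: chain_seq_split.
- by rewrite lowE highE; apply: chain_seq_split.
- by rewrite atom_rank_lt ?label_atom.
- rewrite atom_rank_lt ?label_atom //; apply: label_lt_above => //.
  by rewrite -lb; case: (minimal_labelingP ltxb).
Qed.

(* The comparison of labels is reversed in downR: read from the top, the chains
   decrease along polygon moves. *)
Let upR x : rel L := fun a b => (atom_rank (lam x a) < atom_rank (lam x b))%N.
Let downR z : rel L := fun a b => (atom_rank (lam b z) < atom_rank (lam a z))%N.

Let upR_irr x : irreflexive (upR x). Proof. by move=> a; apply: ltnn. Qed.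
Let upR_trans x : transitive (upR x). Proof. move=> b a e; exact: ltn_trans. Qed.
Let downR_irr x : irreflexive (downR x). Proof. by move=> a; apply: ltnn. Qed.
Let downR_trans x : transitive (downR x).
Proof. by move=> b a e ba eb; apply: ltn_trans ba. Qed.

Lemma chain_descent_lex (m m' : maxchain L) : chain_descent_le Omega lam m m' ->
  edge_lex upR \bot (chain_seq (val m)) (chain_seq (val m')) /\
  edge_lex downR \bot (rev (chain_seq (val m))) (rev (chain_seq (val m'))).
Proof.
case/connectP=> r + ->; elim: r m => [|n r IH] m /=.
  by rewrite !edge_lex_refl.
case/andP=> /polygon_move_swap[p [x [b [y [z [q [-> nE _ up dn]]]]]]] /IH[].
rewrite nE !rev_cat3 => H1 H2; split.
  exact/(edge_lex_trans upR_irr upR_trans _ H1)/edge_lex_cat.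
exact/(edge_lex_trans downR_irr downR_trans _ H2)/edge_lex_cat.
Qed.

(** Common bounds below x for the chains read from the bottom, and above z for the
    chains read from the top, leave room for one element only. *)
Lemma chain_descent_between (m u m' : maxchain L) p x b y z q :
    chain_seq (val m) = p ++ [:: x, b, z & q] ->
    chain_seq (val m') = p ++ [:: x, y, z & q] ->
    chain_descent_le Omega lam m u -> chain_descent_le Omega lam u m' ->
  exists w, chain_seq (val u) = p ++ [:: x, w, z & q].
Proof.
move=> mE m'E /chain_descent_lex[mu mu'] /chain_descent_lex[um um'].
apply: squeezed_seq.
- apply: (edge_lex_prefix upR_irr upR_trans (s := [:: b, z & q])
            (t := [:: y, z & q])); by rewrite -catA /= -?mE -?m'E; eassumption.
- apply: (edge_lex_prefix downR_irr downR_trans (s := [:: b, x & rev p])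
            (t := [:: y, x & rev p]));
    by rewrite -catA /= -rev_cat3 -?mE -?m'E; eassumption.
- by rewrite -(edge_lex_size mu) mE size_cat /=; lia.
Qed.

Lemma minimal_labeling_polygon_complete :
  polygon_complete (mem (atoms L)) Omega lam.
Proof.
split=> [|m m' mm']; first exact: minimal_labeling_EL.
have [p [x [b [y [z [q [mE m'E _ up _]]]]]]] := polygon_move_swap mm'.
have lem' : chain_descent_le Omega lam m m' by apply: connect1.
apply/and3P; split=> //.
  by apply: contraL up => /eqP mm; move: m'E; rewrite -mm mE => /eqP;
    rewrite eqseq_cat // => /andP[_ /eqP[->]]; rewrite ltnn.
apply/forallP => u; apply/implyP => /andP[mu um'].
apply/contraT; rewrite negb_or => /andP[um um'n].
have [v mv vu] := connect_last mu um.
have vm' : chain_descent_le Omega lam v m'.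
  by apply: connect_trans um'; apply: connect1.
have [v' uv' v'm'] : exists2 v', polygon_move Omega lam u v' &
    chain_descent_le Omega lam v' m'.
  by apply: connect_first; rewrite // eq_sym.
have mv' : chain_descent_le Omega lam m v'.
  by apply: connect_trans mu _; apply: connect1.
(* v moves to u and u moves to v'; all three differ from m between x and z only. *)
have [w uE] := chain_descent_between mE m'E mu um'.
have [w1 vE] := chain_descent_between mE m'E mv vm'.
have [w2 v'E] := chain_descent_between mE m'E mv' v'm'.
have [p1 [x1 [b1 [y1 [z1 [q1 [vE1 uE1 l1 up1 _]]]]]]] := polygon_move_swap vu.
have [p2 [x2 [b2 [y2 [z2 [q2 [uE2 vE2 l2 _ dn2]]]]]]] := polygon_move_swap uv'.
have n1 : b1 != y1 by apply: contraTneq up1 => ->; rewrite ltnn.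
have n2 : b2 != y2 by apply: contraTneq dn2 => ->; rewrite ltnn.
rewrite vE in vE1; rewrite uE in uE1 uE2; rewrite v'E in vE2.
have [xx1 _ wy1 zz1] := swap_position n1 vE1 uE1.
have [xx2 wb2 _ zz2] := swap_position n2 uE2 vE2.
(* Arriving at u makes lam x w larger than lam w z, leaving u needs the opposite. *)
move: up1 dn2; rewrite l2 -l1 -xx1 -zz1 -wy1 -xx2 -zz2 -wb2 => up1 dn2.
by have := ltn_trans up1 dn2; rewrite ltnn.
Qed.
End MinimalLabeling.

Theorem theorem4p12 (d : Order.disp_t) (L : finTBLatticeType d)
    (Omega : rel L) :
  geometric_lattice L -> atom_ordering Omega ->
  polygon_strong (mem (atoms L)) Omega (minimal_labeling Omega) /\
  polygon_complete (mem (atoms L)) Omega (minimal_labeling Omega).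
Proof.
move=> geomL ordO; split; first exact: minimal_labeling_polygon_strong.
exact: minimal_labeling_polygon_complete.
Qed.
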